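(* Let $V:\mathbb{R}^n\to\mathbb{R}$ be locally Lipschitz continuous and bounded below. Let $l_i\le u_i$ be real numbers for $i=1,\dots,n$, and let $J:\mathbb{R}^n\to\mathbb{R}\cup\{\pm\infty\}$ be proper, lower-semicontinuous and $\mu$-convex for some $\mu>0$, of the form $J(x)=\sum_{i=1}^n\big(j_i(x_i)+\chi_{[l_i,u_i]}(x_i)\big)$, where each $j_i:\mathbb{R}\to\mathbb{R}\cup\{\pm\infty\}$ is convex, and Lipschitz continuous on $[l_i,u_i]$. Then for any $\tau>0$, any $x^k\in\mathbb{R}^n$ and any $p^k\in\partial J(x^k)$, there exists an update $(x^{k+1},p^{k+1})$ of the Bregman Itoh--Abe scheme (defined in the context) from $(x^k,p^k)$ with time step $\tau$.
   Context: $\chi_{[l,u]}$ is the characteristic function: $0$ on $[l,u]$ and $+\infty$ elsewhere. For convex functions, $\partial$ denotes the convex subdifferential. A proper lower-semicontinuous convex function $J$ is $\mu$-convex if $J(\cdot)-\frac{\mu}{2}\|\cdot\|^2$ is convex ($\|\cdot\|$ the Euclidean norm). Because $J$ is separable, $\partial J(x)=\prod_{i=1}^n[\partial J(x)]_i$ with $[\partial J(x)]_i=\partial\big(j_i+\chi_{[l_i,u_i]}\big)(x_i)$. For a locally Lipschitz function $V$, the Clarke directional derivative is $V^o(x;d)=\limsup_{y\to x,\ \lambda\downarrow 0}\frac{V(y+\lambda d)-V(y)}{\lambda}$, the Clarke subdifferential is $\partial V(x)=\{p\in\mathbb{R}^n: V^o(x;d)\ge\langle d,p\rangle \text{ for all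 } d\in\mathbb{R}^n\}$, and $[\partial V(x)]_i=\{p_i:p\in\partial V(x)\}$. Bregman Itoh--Abe scheme. Given $x^k$, $p^k\in\partial J(x^k)$ and a time step $\tau>0$, write $y^{k,i}=(x^{k+1}_1,\dots,x^{k+1}_i,x^k_{i+1},\dots,x^k_n)$, so $y^{k,0}=x^k$ and $y^{k,n}=x^{k+1}$. A pair $(x^{k+1},p^{k+1})$ is an update if, successively for $i=1,\dots,n$, $$p^{k+1}_i=p^k_i-\tau\,\frac{V(y^{k,i})-V(y^{k,i-1})}{x^{k+1}_i-x^k_i},\qquad p^{k+1}_i\in[\partial J(y^{k,i})]_i,$$ where, if $x^{k+1}_i=x^k_i$, the difference quotient is replaced by some $v^k_i\in[\partial V(y^{k,i-1})]_i$ (so $x^{k+1}_i=x^k_i$, $p^{k+1}_i=p^k_i-\tau v^k_i$ is admissible whenever $p^k_i-\tau v^k_i\in[\partial J(y^{k,i-1})]_i$ for some such $v^k_i$). *)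

(* Defs.v *)
From HB Require Import structures.
From mathcomp Require Import all_boot all_order all_algebra.
From mathcomp Require Import all_classical all_reals all_analysis.

Set Implicit Arguments.
Unset Strict Implicit.
Unset Printing Implicit Defensive.

Import Order.TTheory GRing.Theory Num.Theory.
Import numFieldNormedType.Exports.

Local Open Scope classical_set_scope.
Local Open Scope ring_scope.

(* The library norm `|x| on 'rV[R]_n is the sup norm, so the Euclidean
   structure is set up separately. *)
Definition dotv (R : realType) (n : nat) (x y : 'rV[R]_n) : R :=
  \sum_(i < n) x 0 i * y 0 i.

Definition enorm (R : realType) (n : nat) (x : 'rV[R]_n) : R :=
  Num.sqrt (dotv x x).

(* The choice of the (sup) norm on 'rV[R]_n is immaterial here, since all norms
   on R^n are equivalent. *)
Definition locally_lipschitz (R : realType) (n : nat) (V : 'rV[R]_n -> R) :=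
  forall x : 'rV[R]_n,
    exists2 U, nbhs x U & [lipschitz (V y : R^o) | y in U].

(* Lipschitz continuity of an extended-real-valued function includes its
   finiteness on the set. *)
Definition elipschitz_on (R : realType) (A : set R) (f : R -> \bar R) :=
  (forall t, A t -> f t \is a fin_num) /\
  [lipschitz (fine (f t) : R^o) | t in (A : set R^o)].

Definition char_itv (R : realType) (l u t : R) : \bar R :=
  if (l <= t <= u)%R then 0%E else +oo%E.

(* The dual addition %dE has -oo + +oo = +oo, the convention of convex analysis,
   so that the constrained function is +oo outside [l, u] in all cases. *)
Definition constrained (R : realType) (f : R -> \bar R) (l u t : R) : \bar R :=
  (f t + char_itv l u t)%dE.

Definition eproper (T : Type) (R : realType) (f : T -> \bar R) :=
  (exists x, (f x < +oo)%E) /\ (forall x, (-oo < f x)%E).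

(* Convexity of the epigraph: for functions with values in [-oo, +oo] this needs
   no convention on the sum of -oo and +oo. *)
Definition convex_efunction (R : realType) (E : lmodType R) (f : E -> \bar R) :=
  convex_set [set z : (E * R^o)%type | (f z.1 <= (z.2)%:E)%E].

Definition mu_convex (R : realType) (n : nat) (mu : R) (J : 'rV[R]_n -> \bar R) :=
  convex_efunction (fun x => (J x - (mu / 2 * enorm x ^+ 2)%:E)%E).

(* For a proper J this is empty at the points where J is +oo, as usual. *)
Definition subdiff (R : realType) (n : nat) (J : 'rV[R]_n -> \bar R)
    (x : 'rV[R]_n) : set 'rV[R]_n :=
  [set p | forall y, (J x + (dotv p (y - x))%:E <= J y)%E].

Definition clarke_dir (R : realType) (n : nat) (V : 'rV[R]_n -> R)
    (x d : 'rV[R]_n) : \bar R :=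
  limf_esup
    (fun z : 'rV[R]_n * R => ((V (z.1 + z.2 *: d) - V z.1) / z.2)%:E)
    (filter_prod (nbhs x) ((0 : R)^'+)).

Definition clarke_subdiff (R : realType) (n : nat) (V : 'rV[R]_n -> R)
    (x : 'rV[R]_n) : set 'rV[R]_n :=
  [set p | forall d, ((dotv d p)%:E <= clarke_dir V x d)%E].

(* [A]_i = {p_i : p in A}. For separable J, [subdiff J x]_i is the subdifferential
   of the i-th summand at x_i whenever subdiff J x is nonempty. *)
Definition component (R : realType) (n : nat) (A : set 'rV[R]_n) (i : 'I_n) :
    set R :=
  [set p 0 i | p in A].

(* The first i coordinates come from x1, the others from x0. Coordinates are
   numbered from 0, so processing coordinate i : 'I_n moves the iterate from
   ia_point x0 x1 i to ia_point x0 x1 i.+1. *)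
Definition ia_point (R : realType) (n : nat) (x0 x1 : 'rV[R]_n) (i : nat) :
    'rV[R]_n :=
  \row_(j < n) (if (j < i)%N then x1 0 j else x0 0 j).

(* g is the difference quotient or, when the coordinate does not move, the
   Clarke surrogate replacing it. *)
Definition ia_update (R : realType) (n : nat) (V : 'rV[R]_n -> R)
    (J : 'rV[R]_n -> \bar R) (tau : R) (x0 p0 x1 p1 : 'rV[R]_n) :=
  forall i : 'I_n,
    exists g : R,
      [/\ (x1 0 i <> x0 0 i ->
             g = (V (ia_point x0 x1 i.+1) - V (ia_point x0 x1 i))
                 / (x1 0 i - x0 0 i)),
          (x1 0 i = x0 0 i ->
             component (clarke_subdiff V (ia_point x0 x1 i)) i g),
          p1 0 i = p0 0 i - tau * g &
          component (subdiff J (ia_point x0 x1 i.+1)) i (p1 0 i)].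

(* Main.v *)
Require Import Defs.
From HB Require Import structures.
From mathcomp Require Import all_boot all_order all_algebra.
From mathcomp Require Import all_classical all_reals all_analysis.
From mathcomp Require Import ring lra.

Import Order.TTheory GRing.Theory Num.Theory.
Import numFieldNormedType.Exports.
Import DualAddTheory.

Local Open Scope classical_set_scope.
Local Open Scope ring_scope.

(* Write V°(d) for the Clarke derivative at the current point and t0 for the
   coordinate to be updated. The i-th components of Clarke subgradients are the
   slopes in [a, b], with a = - V°(-e_i) and b = V°(e_i), by the Hahn-Banach
   theorem for the sublinear function V°. If p - tau g is a subgradient at t0
   for some g in [a, b], do not move. Otherwise 0 is not in [a, b], say b < 0,
   and q(t) = p - tau (V(t) - V(t0)) / (t - t0) is too steep to be a subgradient
   for t slightly larger than t0, while no slope is too steep at the end point u.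
   Being too steep and being too flat are open conditions on t, exclusive by
   convexity, so q(t) is a subgradient for some t in (t0, u]. *)

(** * The one-dimensional inclusion, by an intermediate value argument *)

Definition subgrad_on (R : realType) (f : R -> R) (l u t q : R) :=
  forall s, l <= s <= u -> f t + q * (s - t) <= f s.

(** The chord inequality at an intermediate point, with the denominator [r - s] cleared. *)
Definition convex_on (R : realType) (f : R -> R) (l u : R) :=
  forall s t r, l <= s -> s < t -> t < r -> r <= u ->
    f t * (r - s) <= f s * (r - t) + f r * (t - s).

Definition lipschitz_itv (R : realType) (f : R -> R) (l u L : R) :=
  forall s t, l <= s <= u -> l <= t <= u -> `|f s - f t| <= L * `|s - t|.

(* The supremum of the points t at which q t is too steep to be a subgradient,
   as witnessed by a point to the right of t, solves the inclusion. *)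
Lemma subgrad_ivt_right (R : realType) (f q : R -> R) (l u L t0 b s0 : R) :
  convex_on R f l u -> lipschitz_itv R f l u L -> l <= t0 ->
  (forall t, t0 < t -> {for t, continuous q}) ->
  (forall e, 0 < e -> \forall t \near t0^'+, b - e <= q t) ->
  t0 < s0 <= u -> f s0 < f t0 + b * (s0 - t0) ->
  exists2 t, t0 < t <= u & subgrad_on R f l u t (q t).
Proof.
move=> fconv flip lt0 qc qb /andP[t0s0 s0u] fs0.
pose steep t := exists s, t < s <= u /\ f s < f t + q t * (s - t).
pose S := [set t | t0 < t <= u /\ steep t].
have supS : has_sup S.
  split; last by exists u => t [/andP[]].
  (* [A] is the slack in the strict inequality at [s0]; this [e] is chosen so that lowering the
     slope [b] to [b - e] costs only half of it. *)
  pose A := f t0 + b * (s0 - t0) - f s0.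
  pose e := A / (2 * (s0 - t0)).
  have A0 : 0 < A by rewrite /A; lra.
  have e0 : 0 < e by apply: divr_gt0 => //; lra.
  have eA : e * (s0 - t0) = A / 2 by rewrite /e; field; lra.
  (* By the Lipschitz bound and [b - e <= q t], [G] is a continuous minorant of
     [f t + q t * (s0 - t) - f s0] just to the right of [t0]. It equals [A / 2] at [t0], so [s0]
     witnesses steepness there. *)
  pose G t := f t0 - L * `|t - t0| + (b - e) * (s0 - t) - f s0.
  have Gc : {for t0, continuous G}.
    apply: cvgB; last exact: cvg_cst.
    apply: cvgD; last first.
      by apply: cvgMr; apply: cvgB; [exact: cvg_cst|exact: cvg_id].
    apply: cvgB; first exact: cvg_cst.
    apply: cvgMr; apply: cvg_norm; apply: cvgB; [exact: cvg_id|exact: cvg_cst].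
  have G0 : 0 < G t0 by rewrite /G subrr normr0 mulr0 /A in eA A0 *; lra.
  have : \forall t \near t0^'+, S t.
    have Gn : \forall t \near t0^'+, 0 < G t.
      exact: (cvg_at_right_filter Gc) _ (lt_nbhsr G0).
    near=> t; split; first by apply/andP; split; near: t;
      [exact: nbhs_right_gt|exact: nbhs_right_le (lt_le_trans t0s0 s0u)].
    have tt0 : t0 < t by near: t; exact: nbhs_right_gt.
    have ts0 : t < s0 by near: t; exact: nbhs_right_lt.
    exists s0; split; first by rewrite ts0.
    have qt : b - e <= q t by near: t; exact: qb.
    have : 0 < G t by near: t.
    have : `|f t - f t0| <= L * `|t - t0| by apply: flip; lra.
    rewrite ler_norml /G => /andP[Hl _].
    have : (b - e) * (s0 - t) <= q t * (s0 - t) by apply: ler_wpM2r => //; lra.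
    lra.
  by move/filter_ex.
set T := sup S; have t0T : t0 < T.
  have [t St] := supS.1; have [/andP[tt0 _] _] := St.
  exact: lt_le_trans tt0 (ub_le_sup supS.2 St).
have Tu : T <= u by apply: ge_sup supS.1 _ => t [/andP[]].
exists T; first by rewrite t0T.
apply: contrapT => /existsNP[s /not_implyP[sI /negP]]; rewrite -ltNge => fs.
(* If [q T] fails at [s], continuity makes [q t] fail at the same [s] for all [t] near [T], again
   through a continuous minorant. *)
pose G t := f T - L * `|t - T| + q t * (s - t) - f s.
have Gc : {for T, continuous G}.
  apply: cvgB; last exact: cvg_cst.
  apply: cvgD; last first.
    by apply: cvgM; [exact: qc|apply: cvgB; [exact: cvg_cst|exact: cvg_id]].
  apply: cvgB; first exact: cvg_cst.
  apply: cvgMr; apply: cvg_norm; apply: cvgB; [exact: cvg_id|exact: cvg_cst].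
have GT : 0 < G T by rewrite /G subrr normr0 mulr0; lra.
have Gn : \forall t \near T, 0 < G t by exact: Gc _ (lt_nbhsr GT).
have lower t : l <= t <= u -> 0 < G t -> f s < f t + q t * (s - t).
  move=> tI; have : `|f t - f T| <= L * `|t - T| by apply: flip => //; lra.
  by rewrite ler_norml /G => /andP[Hl _]; lra.
case: (ltgtP s T) => [sT|Ts|sT]; last by move: fs; rewrite sT; lra.
(* A failure on the left of [T] makes slopes near [T] too flat, whereas points of [S] arbitrarily
   close to [T] are too steep. At such a point [t], the witnesses [s < t < r] contradict
   convexity. *)
- have : \forall t \near T, 0 < G t /\ s < t.
    by apply: filterI => //; exact: lt_nbhsr.
  move=> /nbhs_ballP[d /= d0 Hd].
  have [t St tT] := sup_adherent d0 supS.
  have tleT : t <= T by apply: ub_le_sup St; exact: supS.2.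
  have [|Gt st] := Hd t.
    by rewrite /ball /= ger0_norm ?subr_ge0// -/T in tT *; lra.
  have [/andP[tt0 tu] [r [/andP[tr ru] fr]]] := St.
  have := lower t ltac:(lra) Gt.
  have := fconv s t r ltac:(lra) st tr ru.
  nra.
(* A failure on the right of [T] puts points beyond [T] into [S]. This covers [T = u] too, since
   [T < s <= u] is then impossible. *)
- have [t [Tt ts Gt]] : exists t, [/\ T < t, t < s & 0 < G t].
    have : \forall t \near T^'+, [/\ T < t, t < s & 0 < G t].
      near=> t; split; near: t; [exact: nbhs_right_gt|exact: nbhs_right_lt|].
      exact: cvg_at_right_filter (cvg_id) _ Gn.
    by move/filter_ex.
  have : S t.
    split; first lra.
    exists s; split; first lra.
    by apply: lower => //; lra.
  by move=> /(ub_le_sup supS.2); rewrite -/T; lra.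
Unshelve. all: by end_near. Qed.

(** The reflection of the axis at [0] reverses the sign of slopes and exchanges the two sides of
    [t0]. *)
Lemma subgrad_ivt_left (R : realType) (f q : R -> R) (l u L t0 b s0 : R) :
  convex_on R f l u -> lipschitz_itv R f l u L -> t0 <= u ->
  (forall t, t < t0 -> {for t, continuous q}) ->
  (forall e, 0 < e -> \forall t \near t0^'-, q t <= b + e) ->
  l <= s0 < t0 -> f s0 < f t0 + b * (s0 - t0) ->
  exists2 t, l <= t < t0 & subgrad_on R f l u t (q t).
Proof.
move=> fconv flip t0u qc qb s0I fs0.
have [|||||||t tI ft] := @subgrad_ivt_right R (f \o -%R) (fun t => - q (- t))
    (- u) (- l) L (- t0) (- b) (- s0).
- move=> s t r us st tr rl /=.
  have [rs st' tr' sl] :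
      [/\ l <= - r, - r < - t, - t < - s & - s <= u] by split; lra.
  by have := fconv _ _ _ rs st' tr' sl; lra.
- move=> s t sI tI /=; have := flip (- s) (- t) ltac:(lra) ltac:(lra).
  by rewrite -opprD normrN.
- lra.
- move=> t tt0; apply: continuousN; apply: continuous_comp.
    exact: oppr_continuous.
  by apply: qc; lra.
- move=> e e0; rewrite at_rightN; apply: filterS (qb e e0) => t qt /=.
  by rewrite opprK; lra.
- lra.
- by rewrite /= !opprK; lra.
- exists (- t); first lra.
  move=> s sI; have := ft (- s) ltac:(lra); rewrite /= opprK; lra.
Qed.

Lemma exists_itoh_abe_step (R : realType) (f W : R -> R)
    (l u L t0 p a b tau : R) :
  convex_on R f l u -> lipschitz_itv R f l u L -> l <= t0 <= u ->
  continuous W -> 0 < tau -> a <= b -> subgrad_on R f l u t0 p ->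
  (forall e, 0 < e ->
     \forall t \near t0^'+, (W t - W t0) / (t - t0) <= b + e) ->
  (forall e, 0 < e ->
     \forall t \near t0^'-, a - e <= (W t - W t0) / (t - t0)) ->
  exists t g, [/\ l <= t <= u,
    t <> t0 -> g = (W t - W t0) / (t - t0),
    t = t0 -> a <= g <= b &
    subgrad_on R f l u t (p - tau * g)].
Proof.
move=> fconv flip t0I Wc tau0 ab fp Wr Wl.
pose q t := p - tau * ((W t - W t0) / (t - t0)).
have qc t : t != t0 -> {for t, continuous q}.
  move=> tt0; apply: cvgB; first exact: cvg_cst.
  apply: cvgMr; apply: cvgM.
    by apply: cvgB; [exact: Wc|exact: cvg_cst].
  by apply: cvgV; [lra|apply: cvgB; [exact: cvg_id|exact: cvg_cst]].
have stay g : a <= g <= b -> subgrad_on R f l u t0 (p - tau * g) ->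
    exists t g, [/\ l <= t <= u,
    t <> t0 -> g = (W t - W t0) / (t - t0),
    t = t0 -> a <= g <= b &
    subgrad_on R f l u t (p - tau * g)].
  by move=> gI fg; exists t0, g; split.
have [b0|b0] := ltP b 0.
  case: (EM (subgrad_on R f l u t0 (p - tau * b))) => [|].
    by apply: stay; lra.
  move=> /existsNP[s /not_implyP[sI /negP]]; rewrite -ltNge => fs.
  (* As [p] is a subgradient at [t0], raising the slope by [- tau * b > 0] can only break the
     inequality to the right of [t0]. *)
  have ts : t0 < s.
    rewrite ltNge; apply/negP => st.
    have := fp s sI; have : 0 <= (tau * b) * (s - t0).
      by apply: mulr_le0; [apply: mulr_ge0_le0; lra|lra].
    lra.
  have [|||||t tI ft] :=
    @subgrad_ivt_right R f q l u L t0 (p - tau * b) s fconv flip.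
  - lra.
  - by move=> t tt0; apply: qc; rewrite gt_eqF.
  - move=> e e0; have et : 0 < e / tau by apply: divr_gt0.
    near=> t; rewrite /q.
    have : (W t - W t0) / (t - t0) <= b + e / tau by near: t; exact: Wr.
    rewrite -(ler_pM2l tau0) mulrDr [tau * (e / tau)]mulrC divfK ?gt_eqF//.
    lra.
  - lra.
  - done.
  - exists t, ((W t - W t0) / (t - t0)); split=> //; lra.
(* When [a <= 0 <= b], the choice [g = 0] keeps the subgradient [p]; the case [0 < a] mirrors
   [b < 0]. *)
have [a0|a0] := ltP 0 a; last first.
  by apply: (stay 0); [lra|rewrite mulr0 subr0].
case: (EM (subgrad_on R f l u t0 (p - tau * a))) => [|].
  by apply: stay; lra.
move=> /existsNP[s /not_implyP[sI /negP]]; rewrite -ltNge => fs.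
have ts : s < t0.
  rewrite ltNge; apply/negP => st.
  have := fp s sI; have : 0 <= (tau * a) * (s - t0).
    by apply: mulr_ge0; [apply: mulr_ge0; lra|lra].
  lra.
have [|||||t tI ft] :=
  @subgrad_ivt_left R f q l u L t0 (p - tau * a) s fconv flip.
- lra.
- by move=> t tt0; apply: qc; rewrite lt_eqF.
- move=> e e0; have et : 0 < e / tau by apply: divr_gt0.
  near=> t; rewrite /q.
  have : a - e / tau <= (W t - W t0) / (t - t0) by near: t; exact: Wl.
  rewrite -(ler_pM2l tau0) mulrBr [tau * (e / tau)]mulrC divfK ?gt_eqF//.
  lra.
- lra.
- done.
- exists t, ((W t - W t0) / (t - t0)); split=> //; lra.
Unshelve. all: by end_near. Qed.

(** * Sublinear functions and the Hahn-Banach theorem *)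

Definition sublinear (R : realType) (E : lmodType R) (h : E -> R) :=
  (forall x y, h (x + y) <= h x + h y) /\
  (forall a x, 0 < a -> h (a *: x) <= a * h x).

(** Homogeneity is required as an inequality only, but for all positive factors: the factor 2 gives
    [0 <= h 0], the factor 1/2 gives [h 0 <= 0]. *)
Lemma sublinear0 (R : realType) (E : lmodType R) (h : E -> R) :
  sublinear R E h -> h 0 = 0.
Proof.
move=> [_ hZ]; have := hZ 2 0 ltac:(lra); have := hZ (1 / 2) 0 ltac:(lra).
by rewrite !scaler0; lra.
Qed.

(** The new function is the infimum over [t] of [h (x + t *: v) - t * a]. The condition on [a] says
    that the linear map [t *: v] to [t * a] stays below [h] on the line spanned by [v], which keeps
    the infimum finite. *)
Lemma sublinear_linearize (R : realType) (E : lmodType R) (h : E -> R) (v : E)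
    (a : R) : sublinear R E h -> - h (- v) <= a <= h v ->
  exists h', [/\ sublinear R E h', forall x, h' x <= h x, h' v <= a &
    h' (- v) <= - a].
Proof.
move=> hs av; have h0 := sublinear0 _ _ _ hs; case: hs => hD hZ.
have hline t : t * a <= h (t *: v).
  case: (ltgtP t 0) => [t0|t0|->]; last by rewrite mul0r scale0r h0.
  - have t0' : 0 < - t by lra.
    have := hZ (- t)^-1 (t *: v) ltac:(by rewrite invr_gt0).
    rewrite scalerA invrN mulNr mulVf ?lt_eqF// scaleN1r => H.
    have : h (- v) * - t <= h (t *: v).
      by rewrite -ler_pdivlMr// mulrC invrN.
    nra.
  - have := hZ t^-1 (t *: v) ltac:(by rewrite invr_gt0).
    rewrite scalerA mulVf ?gt_eqF// scale1r => H.
    have : h v * t <= h (t *: v) by rewrite -ler_pdivlMr// mulrC.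
    nra.
pose S x := [set h (x + t *: v) - t * a | t in [set: R]].
have lbS x : has_lbound (S x).
  exists (- h (- x)) => _ [t _ <-].
  have := hD (x + t *: v) (- x); rewrite addrAC subrr add0r.
  have := hline t; lra.
have hinf x : has_inf (S x) by split; [exists (h (x + 0 *: v) - 0 * a), 0|].
have infle x t : inf (S x) <= h (x + t *: v) - t * a.
  by apply: ge_inf => //; exists t.
exists (fun x => inf (S x)); split.
- split=> [x y|b x b0].
  + apply/ler_addgt0Pr => e e0; have e2 : 0 < e / 2 by lra.
    have [_ [t _ <-] Ht] := inf_adherent e2 (hinf x).
    have [_ [t' _ <-] Ht'] := inf_adherent e2 (hinf y).
    have := infle (x + y) (t + t'); have := hD (x + t *: v) (y + t' *: v).
    rewrite addrACA -scalerDl => H1 H2.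
    by move: Ht Ht'; rewrite -/(S x) -/(S y); lra.
  + apply/ler_addgt0Pr => e e0; have eb : 0 < e / b by apply: divr_gt0.
    have [_ [t _ <-] Ht] := inf_adherent eb (hinf x).
    have := infle (b *: x) (b * t); have := hZ b (x + t *: v) b0.
    rewrite scalerDr scalerA => H1 H2.
    have : b * (h (x + t *: v) - t * a) < b * (inf (S x) + e / b).
      by rewrite ltr_pM2l.
    rewrite [b * (inf _ + _)]mulrDr [b * (e / b)]mulrC divfK ?gt_eqF//; lra.
- by move=> x; have := infle x 0; rewrite scale0r addr0 mul0r subr0.
- by have := infle v (- 1); rewrite scaleN1r subrr h0; lra.
- by have := infle (- v) 1; rewrite scale1r addNr h0; lra.
Qed.

(* Hahn-Banach, by making h linear along one coordinate axis after the other. *)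
Lemma sublinear_ge_dotv (R : realType) (n : nat) (h : 'rV[R]_n -> R) (i : 'I_n)
    (g : R) :
  sublinear R _ h -> - h (- delta_mx 0 i) <= g <= h (delta_mx 0 i) ->
  exists2 p : 'rV[R]_n, p 0 i = g & forall d, dotv d p <= h d.
Proof.
move=> hs /(sublinear_linearize _ _ _ _ _ hs)[h0 [h0s h0h h0g h0g']].
(* Linearity along an axis is recorded as an inequality that is inherited by smaller functions, so
   later axes do not spoil earlier ones. *)
have : exists h', [/\ sublinear R _ h', forall x, h' x <= h0 x &
    forall k, k \in enum 'I_n -> h' (delta_mx 0 k) + h' (- delta_mx 0 k) <= 0].
  elim: (enum 'I_n) => [|k s [h' [h's h'h h'k]]]; first by exists h0.
  (* The slope along axis [k] is free; the largest admissible one is taken. *)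
  have hk : - h' (- delta_mx 0 k) <= h' (delta_mx 0 k) <= h' (delta_mx 0 k).
    have := h's.1 (delta_mx 0 k) (- delta_mx 0 k).
    rewrite subrr (sublinear0 _ _ _ h's); lra.
  have [h2 [h2s h2h h2k h2k']] := sublinear_linearize _ _ _ _ _ h's hk.
  exists h2; split=> // [x|m]; first exact: le_trans (h2h x) (h'h x).
  rewrite inE => /predU1P[->|/h'k]; first lra.
  have := h2h (delta_mx 0 m); have := h2h (- delta_mx 0 m); lra.
move=> [h' [h's h'h h'k]].
have h'0 := sublinear0 _ _ _ h's.
pose p := \row_k h' (delta_mx 0 k).
have ax k c : h' (c *: delta_mx 0 k) <= c * p 0 k.
  rewrite mxE; case: (ltgtP c 0) => [c0|c0|->].
  - have c0' : 0 < - c by lra.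
    have := h's.2 (- c) (- delta_mx 0 k) c0'.
    rewrite scalerN scaleNr opprK.
    have := h'k k (mem_enum _ k); nra.
  - exact: h's.2.
  - by rewrite scale0r mul0r h'0.
have up d : h' d <= dotv d p.
  rewrite [d in h' d]row_sum_delta /dotv.
  elim/big_rec2: _ => [|k y x _ xy]; first by rewrite h'0.
  by apply: le_trans (h's.1 _ _) _; apply: lerD.
exists p => [|d].
  rewrite mxE; have := h's.1 (delta_mx 0 i) (- delta_mx 0 i).
  have := h'h (delta_mx 0 i); have := h'h (- delta_mx 0 i).
  rewrite subrr h'0; lra.
(* The bound [up] at [- d] and [0 <= h' d + h' (- d)] give the reverse of [up] at [d], so [h'] is
   linear. *)
apply: le_trans (h0h d); apply: le_trans (h'h d).
have := h's.1 d (- d); have := up (- d); rewrite subrr h'0.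
have -> : dotv (- d) p = - dotv d p.
  by rewrite /dotv -sumrN; apply: eq_bigr => k _; rewrite mxE mulNr.
lra.
Qed.

(** * Clarke directional derivatives of locally Lipschitz functions *)

Section clarke.
Variables (R : realType) (n : nat) (V : 'rV[R]_n -> R).
Hypothesis V_lip : locally_lipschitz V.
Implicit Types (x y d : 'rV[R]_n) (z : 'rV[R]_n * R).

Local Notation F x := (filter_prod (nbhs x) ((0 : R)^'+)).
Local Notation Q d z := ((V (z.1 + z.2 *: d) - V z.1) / z.2).

Lemma near_clarke_gt0 x : \forall z \near F x, 0 < z.2.
Proof.
exists ([set: 'rV[R]_n], [set t : R | 0 < t]); last by move=> z [].
by split; [exact: filterT|exact: nbhs_right_gt].
Qed.

(** This allows the base point of a difference quotient to be moved along [d] inside the limit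
    superior. *)
Lemma cvg_clarke_shift x d : (fun z => z.1 + z.2 *: d) @ F x --> x.
Proof.
rewrite -[X in _ --> X]addr0 -(scale0r d).
apply: cvgD; first exact: cvg_fst.
apply: cvgZr_tmp; apply: cvg_trans cvg_snd _; exact: cvg_within.
Qed.

Lemma near_clarke_lipschitz x :
  exists L : R, forall d,
    \forall z \near F x, `|V (z.1 + z.2 *: d) - V z.1| <= L * `|z.2 *: d|.
Proof.
have [U xU /pinfty_ex_gt0[L L0 HL]] := V_lip x.
exists L => d.
have U1 : \forall z \near F x, U z.1 by exact: (@cvg_fst _ _ (nbhs x)) _ xU.
have U2 : \forall z \near F x, U (z.1 + z.2 *: d).
  exact: cvg_clarke_shift xU.
apply: filterS2 U1 U2 => z Uz Uzd.
have := HL (z.1 + z.2 *: d, z.1) (conj Uzd Uz).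
by rewrite /= [_ + _ - z.1]addrC addKr.
Qed.

Lemma continuous_locally_lipschitz : continuous V.
Proof.
move=> x; have [U xU /pinfty_ex_gt0[L L0 HL]] := V_lip x.
apply/(@cvgrPdist_le _ _ _ _ (nbhs_filter x)) => e e0.
have xe : \forall y \near x, `|x - y| < e / L.
  by have := nbhsx_ballx x (e / L) (divr_gt0 e0 L0); rewrite -ball_normE.
have Ux := nbhs_singleton xU; apply: filterS2 xU xe => y Uy ye.
have := HL (x, y) (conj Ux Uy) => /le_trans; apply => /=.
by rewrite mulrC -ler_pdivlMr//; exact: ltW.
Qed.

(** The limit superior is an infimum, over the sets of the filter, of suprema; the sublevel sets of
    the quotient serve as test sets. *)
Lemma clarke_dir_leP x d (c : R) :
  (clarke_dir V x d <= c%:E)%E <->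
  forall e, 0 < e -> \forall z \near F x, Q d z <= c + e.
Proof.
split=> [le_c e e0|le_c].
- have : (clarke_dir V x d < (c + e)%:E)%E.
    by apply: le_lt_trans le_c _; rewrite lte_fin ltrDl.
  move=> /ereal_inf_lt[_ [A FA <-] sup_lt].
  apply: filterS FA => z Az.
  rewrite -lee_fin; apply: le_trans (ltW sup_lt).
  by apply: ereal_sup_ubound; exists z.
- apply/lee_addgt0Pr => e e0; apply: ereal_inf_le.
  exists (ereal_sup [set (Q d z)%:E | z in [set z | Q d z <= c + e]]).
    by exists [set z | Q d z <= c + e] => //; exact: le_c.
  by apply: ge_ereal_sup => _ [z /= Hz <-]; rewrite -EFinD lee_fin.
Qed.

(** Near [x] the quotients are bounded in absolute value by [L] times the norm of [d]. *)
Lemma clarke_dir_fin x d : clarke_dir V x d \is a fin_num.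
Proof.
have [L HL] := near_clarke_lipschitz x.
have HQ : \forall z \near F x, `|Q d z| <= L * `|d|.
  near=> z; have z20 : 0 < z.2 by near: z; exact: near_clarke_gt0.
  rewrite normrM normfV (gtr0_norm z20) ler_pdivrMr// -mulrA.
  rewrite [`|d| * _]mulrC -{2}(gtr0_norm z20) -normrZ.
  by near: z; exact: HL.
rewrite fin_numElt; apply/andP; split; last first.
  apply: (@le_lt_trans _ _ (L * `|d|)%:E); last exact: ltry.
  apply/clarke_dir_leP => e e0; apply: filterS HQ => z.
  by rewrite ler_norml; lra.
apply: (@lt_le_trans _ _ (- (L * `|d|))%:E); first exact: ltNyr.
apply: le_ereal_inf_tmp => _ [A FA <-].
have [z [Az Qz]] := filter_ex (filterI FA HQ).
apply: (@le_trans _ _ (Q d z)%:E).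
  by rewrite lee_fin; move: Qz; rewrite ler_norml => /andP[].
by apply: ereal_sup_ubound; exists z.
Unshelve. all: by end_near. Qed.

Lemma fine_clarke_dir_leP x d (c : R) :
  fine (clarke_dir V x d) <= c <->
  forall e, 0 < e -> \forall z \near F x, Q d z <= c + e.
Proof.
by rewrite -clarke_dir_leP -{2}(fineK (clarke_dir_fin x d)) lee_fin.
Qed.

(** For subadditivity, the quotient along [d + d'] splits into the one along [d] based at
    [z.1 + z.2 *: d'] and the one along [d'] based at [z.1]. For homogeneity, the factor [a] is
    absorbed into the step length [z.2]. *)
Lemma sublinear_clarke_dir x :
  sublinear R _ (fun d => fine (clarke_dir V x d)).
Proof.
split=> [d d'|a d a0].
- apply/fine_clarke_dir_leP => e e0; have e2 : 0 < e / 2 by lra.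
  have H := (fine_clarke_dir_leP x d _).1 (lexx _) _ e2.
  have H' := (fine_clarke_dir_leP x d' _).1 (lexx _) _ e2.
  have {}H : \forall z \near F x,
      Q d (z.1 + z.2 *: d', z.2) <= fine (clarke_dir V x d) + e / 2.
    have : (fun z => (z.1 + z.2 *: d', z.2)) @ F x --> F x.
      exact: (cvg_pair (cvg_clarke_shift x d') cvg_snd).
    by move/(_ _ H).
  apply: filterS2 H H' => z /=.
  rewrite scalerDr addrA [z.1 + _ + _]addrAC !mulrBl; lra.
- apply/fine_clarke_dir_leP => e e0; have ea : 0 < e / a by apply: divr_gt0.
  have H := (fine_clarke_dir_leP x d _).1 (lexx _) _ ea.
  have {}H : \forall z \near F x,
      Q d (z.1, a * z.2) <= fine (clarke_dir V x d) + e / a.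
    have scale : a * t @[t --> (0 : R)^'+] --> (0 : R)^'+.
      move=> A [r /= r0 rA]; exists (r / a) => /=; first exact: divr_gt0.
      move=> t /= tr t0; apply: rA => /=; last exact: mulr_gt0.
      move: tr; rewrite !sub0r !normrN normrM (gtr0_norm a0).
      by rewrite ltr_pdivlMr// mulrC.
    have : (fun z => (z.1, a * z.2)) @ F x --> F x.
      exact: (cvg_pair cvg_fst (cvg_comp _ _ cvg_snd scale)).
    by move/(_ _ H).
  apply: filterS H => z /=.
  rewrite -(ler_pM2l a0) mulrDr [a * (e / a)]mulrC divfK ?gt_eqF//.
  rewrite invfM mulrCA [a * (_ * _)]mulrA mulfV ?gt_eqF// mul1r.
  by rewrite scalerA [z.2 * a]mulrC.
Qed.

Lemma component_clarke_subdiff x i (g : R) :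
  - fine (clarke_dir V x (- delta_mx 0 i)) <= g
    <= fine (clarke_dir V x (delta_mx 0 i)) ->
  component (clarke_subdiff V x) i g.
Proof.
move=> /(sublinear_ge_dotv _ _ _ _ _ (sublinear_clarke_dir x))[p pg ph].
exists p => // d.
by rewrite -(fineK (clarke_dir_fin x d)) lee_fin.
Qed.

(** The bound on all nearby quotients is restricted to those whose base point is [x] itself. *)
Lemma clarke_dir_near_right x d (e : R) : 0 < e ->
  \forall t \near (0 : R)^'+,
    (V (x + t *: d) - V x) / t <= fine (clarke_dir V x d) + e.
Proof.
move=> e0; have H := (fine_clarke_dir_leP x d _).1 (lexx _) _ e0.
have : (fun t : R => (x, t)) @ (0 : R)^'+ --> F x.
  exact: (cvg_pair (cvg_cst x) cvg_id).
by move/(_ _ H).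
Qed.

End clarke.

(** * Subdifferentials of separable functions on a box *)

Section separable.
Variables (R : realType) (n : nat) (l u : 'I_n -> R) (j : 'I_n -> R -> \bar R).
Variable J : 'rV[R]_n -> \bar R.
Hypothesis j_lip : forall i, elipschitz_on `[l i, u i] (j i).
Hypothesis J_sep : forall x, J x =
  (\sum_(i < n) constrained (j i) (l i) (u i) (x 0%R i))%E.

Let f i t := fine (j i t).
Let box := [set x : 'rV[R]_n | forall i, l i <= x 0 i <= u i].

Lemma separable_box x : box x -> J x = (\sum_(i < n) f i (x 0 i))%:E.
Proof.
move=> xb; rewrite J_sep -sumEFin; apply: eq_bigr => i _.
rewrite /constrained /char_itv xb dadde0 fineK//.
by apply: (j_lip i).1; rewrite /= in_itv /= xb.
Qed.

(** One summand is [+oo], and none is [-oo]: [j k] is finite on its interval, and the dual sum is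
    [+oo] outside it. *)
Lemma separable_out x : ~ box x -> J x = +oo%E.
Proof.
move=> /existsNP[i /negP xi]; rewrite J_sep; apply/eqP.
rewrite esum_eqy; last first.
  move=> k _; rewrite /constrained /char_itv; case: ifPn => [tI|_]; last first.
    by rewrite daddey.
  have : j k (x 0 k) \is a fin_num by apply: (j_lip k).1; rewrite /= in_itv.
  by rewrite dadde0 fin_numE => /andP[].
by apply/existsP; exists i; rewrite /constrained /char_itv (negbTE xi) daddey.
Qed.

(** Summing the coordinate inequalities gives one direction. For the other, comparison with the
    corner [l], where [J] is finite, puts [x] in the box, and test points differing from [x] in one
    coordinate isolate a summand. *)
Lemma subdiff_separable (le_lu : forall i, l i <= u i) x p :
  subdiff J x p <->
  box x /\ forall i, subgrad_on R (f i) (l i) (u i) (x 0 i) (p 0 i).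
Proof.
split=> [xp|[xb xp] y]; last first.
  have [yb|/separable_out ->] := pselect (box y); last exact: leey.
  rewrite !separable_box// -EFinD lee_fin /dotv -big_split/=.
  by apply: ler_sum => i _; rewrite !mxE; exact: xp.
have xb : box x.
  apply: contrapT => /separable_out Jx; have := xp (\row_i l i).
  by rewrite Jx separable_box// => i; rewrite mxE lexx le_lu.
split=> // i s sI.
pose y := x + (s - x 0 i) *: delta_mx 0 i.
have yE k : y 0 k = if k == i then s else x 0 k.
  rewrite !mxE eqxx /=; case: eqVneq => [->|_]; first by rewrite mulr1 subrKC.
  by rewrite mulr0 addr0.
have yb : box y by move=> k; rewrite yE; case: eqVneq => [->|].
have dotE : dotv p (y - x) = p 0 i * (s - x 0 i).
  rewrite /dotv (bigD1 i)//= big1 ?addr0 => [|k /negPf ki].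
    by rewrite !mxE !eqxx mulr1 addrAC subrr add0r.
  by rewrite !mxE ki /= mulr0 addr0 subrr mulr0.
have := xp y; rewrite !separable_box// -EFinD lee_fin dotE.
rewrite (bigD1 i)//= [in leRHS](bigD1 i)//= yE eqxx.
rewrite [in leRHS](eq_bigr (fun k => f k (x 0 k))); first lra.
by move=> k /negPf ki; rewrite yE ki.
Qed.

End separable.

(** * Passage from extended-real-valued to real-valued functions on an interval *)

Lemma convex_on_fine (R : realType) (g : R -> \bar R) (l u : R) :
  convex_efunction (g : R^o -> \bar R) ->
  (forall t, l <= t <= u -> g t \is a fin_num) ->
  convex_on R (fun t => fine (g t)) l u.
Proof.
move=> gconv gfin s t r ls st tr ru.
have rs : 0 < r - s by lra.
(* The weight for which [t] is the convex combination [a * s + (1 - a) * r]. *)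
pose a := (r - t) / (r - s).
have aE : a * (r - s) = r - t by rewrite /a divfK// gt_eqF.
have a01 : 0 < a < 1.
  by rewrite divr_gt0 ?ltr_pdivrMr//; lra.
have [gs gt gr] :
    [/\ g s \is a fin_num, g t \is a fin_num & g r \is a fin_num].
  by split; apply: gfin; lra.
pose k : {i01 R} := Itv01 (ltW (andP a01).1) (ltW (andP a01).2).
pose E := [set z : (R^o * R^o)%type | (g z.1 <= (z.2)%:E)%E].
have inE' w : g w \is a fin_num -> ((w, fine (g w)) : R^o * R^o) \in E.
  by move=> gw; rewrite inE /E /= fineK.
have := gconv _ _ k (inE' _ gs) (inE' _ gr).
rewrite inE /= => H.
have {H} : (g (a * s + (1 - a) * r)%R <=
    (a * fine (g s) + (1 - a) * fine (g r))%R%:E)%E by exact: H.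
have -> : a * s + (1 - a) * r = t by lra.
rewrite -[g t]fineK// lee_fin -(ler_pM2r rs) mulrDl.
by rewrite ![_ * fine _ * _]mulrAC aE [(1 - a) * _]mulrBl mul1r aE; lra.
Qed.

Lemma elipschitz_itv (R : realType) (g : R -> \bar R) (l u : R) :
  elipschitz_on `[l, u] g ->
  exists L, lipschitz_itv R (fun t => fine (g t)) l u L.
Proof.
move=> [_ /pinfty_ex_gt0[L L0 HL]]; exists L => s t sI tI.
by apply: (HL (s, t)); split; rewrite /= in_itv.
Qed.

(** * Updating one coordinate, and then all of them in turn *)

Section coordinate.
Variables (R : realType) (n : nat).
Implicit Types x y p : 'rV[R]_n.

Lemma ia_pointS x0 x1 (i : 'I_n) :
  ia_point x0 x1 i.+1 =
  ia_point x0 x1 i + (x1 0 i - x0 0 i) *: delta_mx 0 i.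
Proof.
apply/rowP => k; rewrite !mxE ltnS eqxx /=.
case: (ltngtP k i) => [ki|ki|/val_inj ->].
- by rewrite -val_eqE/= ltn_eqF// mulr0 addr0.
- by rewrite -val_eqE/= gtn_eqF// mulr0 addr0.
- by rewrite eqxx mulr1 subrKC.
Qed.

(** Intermediate points depend only on coordinates already processed, so [x1] can be built one
    coordinate at a time. *)
Lemma eq_ia_point x0 x1 x1' m :
  (forall k : 'I_n, (k < m)%N -> x1 0 k = x1' 0 k) ->
  ia_point x0 x1 m = ia_point x0 x1' m.
Proof.
move=> x11'; apply/rowP => k; rewrite !mxE.
by case: ifP => // km; exact: x11'.
Qed.

(** The scalar step is applied to the restriction [W] of [V] to the axis line through [y], with the
    Clarke derivatives along the two axis directions supplying [a] and [b]. *)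
Lemma exists_coordinate_step (V : 'rV[R]_n -> R) (f : R -> R)
    (l u L tau t0 p : R) y i :
  locally_lipschitz V -> convex_on R f l u -> lipschitz_itv R f l u L ->
  l <= t0 <= u -> 0 < tau -> subgrad_on R f l u t0 p ->
  exists t g, [/\ l <= t <= u,
    t <> t0 -> g = (V (y + (t - t0) *: delta_mx 0 i) - V y) / (t - t0),
    t = t0 -> component (clarke_subdiff V y) i g &
    subgrad_on R f l u t (p - tau * g)].
Proof.
move=> V_lip fconv flip t0I tau0 fp.
pose e := delta_mx 0 i : 'rV[R]_n.
pose W t := V (y + (t - t0) *: e).
pose b := fine (clarke_dir V y e); pose a := - fine (clarke_dir V y (- e)).
have W0 : W t0 = V y by rewrite /W subrr scale0r addr0.
have ab : a <= b.
  have hs := sublinear_clarke_dir _ _ _ V_lip y.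
  have := hs.1 e (- e); rewrite subrr (sublinear0 _ _ _ hs) /a /b; lra.
have [|||t [g [tI gW gab fg]]] :=
    exists_itoh_abe_step R f W l u L t0 p a b tau fconv flip t0I _ tau0 ab fp.
- move=> t; apply: continuous_comp.
    apply: cvgD; first exact: cvg_cst.
    by apply: cvgZr_tmp; apply: cvgB; [exact: cvg_id|exact: cvg_cst].
  exact: continuous_locally_lipschitz.
- move=> r r0; apply/nbhs_right0P.
  apply: filterS (clarke_dir_near_right _ _ _ V_lip y e r r0) => t.
  by rewrite W0 /W [t0 + t]addrC addrK.
(* A quotient to the left is minus a quotient to the right in direction [- e], so the upper bound
   for the latter becomes the lower bound with [a]. *)
- move=> r r0; apply/nbhs_left0P.
  apply: filterS (clarke_dir_near_right _ _ _ V_lip y (- e) r r0) => t.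
  rewrite W0 /W [t0 - t]addrC addrK invrN mulrN scaleNr -scalerN /a; lra.
exists t, g; split=> // [/gW|/gab]; first by rewrite W0.
exact: component_clarke_subdiff.
Qed.

End coordinate.

Theorem lemma4p1 (R : realType) (n : nat)
  (V : 'rV[R]_n -> R)
  (V_lip : locally_lipschitz V)
  (V_lb : has_lbound (range V))
  (l u : 'I_n -> R)
  (le_lu : forall i, l i <= u i)
  (j : 'I_n -> R -> \bar R)
  (j_convex : forall i, convex_efunction (j i : R^o -> \bar R))
  (j_lip : forall i, elipschitz_on `[l i, u i] (j i))
  (J : 'rV[R]_n -> \bar R)
  (J_sep : forall x, J x =
     (\sum_(i < n) constrained (j i) (l i) (u i) (x 0%R i))%E)
  (J_proper : eproper J)
  (J_lsc : lower_semicontinuous J)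
  (mu : R) (mu_gt0 : 0 < mu)
  (J_mu_convex : mu_convex mu J)
  (tau : R) (tau_gt0 : 0 < tau)
  (xk pk : 'rV[R]_n)
  (pk_subdiff : subdiff J xk pk) :
  exists xk1 pk1 : 'rV[R]_n, ia_update V J tau xk pk xk1 pk1.
Proof.
pose f i t := fine (j i t).
pose D i t q := l i <= t <= u i /\ subgrad_on R (f i) (l i) (u i) t q.
have subdiffP x p : subdiff J x p <-> forall i, D i (x 0 i) (p 0 i).
  rewrite (subdiff_separable _ _ _ _ _ _ j_lip J_sep le_lu).
  split=> [[xb xp] i|xp]; first by split; [exact: xb|exact: xp].
  by split=> i; case: (xp i).
have Dk : forall i, D i (xk 0 i) (pk 0 i) by exact/subdiffP.
(* Induction on the number of processed coordinates. The subgradient condition is kept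
   coordinatewise through [D], so that it does not involve the coordinates still to come. *)
suff /(_ n (leqnn n))[x1 [p1 H]] : forall m, (m <= n)%N ->
    exists x1 p1 : 'rV[R]_n, forall i : 'I_n, (i < m)%N -> exists g : R,
      [/\ x1 0 i <> xk 0 i ->
            g = (V (ia_point xk x1 i.+1) - V (ia_point xk x1 i))
                / (x1 0 i - xk 0 i),
          x1 0 i = xk 0 i ->
            component (clarke_subdiff V (ia_point xk x1 i)) i g,
          p1 0 i = pk 0 i - tau * g &
          D i (x1 0 i) (p1 0 i)].
  exists x1, p1 => i; have [g [Hg Hg' p1i Di]] := H i (ltn_ord i).
  exists g; split=> //.
  (* A full subgradient at the intermediate point takes new components where the coordinate is
     processed and old ones elsewhere. *)
  exists (ia_point pk p1 i.+1); last by rewrite mxE ltnSn.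
  apply/subdiffP => k; rewrite !mxE; case: ifP => _; last exact: Dk.
  by have [? []] := H k (ltn_ord k).
elim=> [_|m IHm mn]; first by exists xk, pk.
have [x1 [p1 IH]] := IHm (ltnW mn).
pose i0 := Ordinal mn; have [xkI fpk] := Dk i0.
have fconv : convex_on R (f i0) (l i0) (u i0).
  apply: convex_on_fine => // t tI.
  by apply: (j_lip i0).1; rewrite /= in_itv.
have [L flip] := elipschitz_itv _ _ _ _ (j_lip i0).
have [t [g [tI gV gC fg]]] := exists_coordinate_step _ _ V (f i0) _ _ L _ _ _
  (ia_point xk x1 m) i0 V_lip fconv flip xkI tau_gt0 fpk.
pose upd (x : 'rV[R]_n) (c : R) := \row_k (if k == i0 then c else x 0 k).
exists (upd x1 t), (upd p1 (pk 0 i0 - tau * g)) => i im.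
(* Overwriting coordinate [m] leaves the intermediate points up to index [m] unchanged. For [i < m]
   both [i] and [i.+1] are in this range, so the earlier conditions persist. *)
have ptE k : (k <= m)%N -> ia_point xk (upd x1 t) k = ia_point xk x1 k.
  move=> km; apply: eq_ia_point => r rk; rewrite mxE -val_eqE/= ltn_eqF//.
  exact: leq_trans rk km.
move: im; rewrite ltnS leq_eqVlt => /predU1P[im|im].
  have -> : i = i0 by exact: val_inj.
  exists g; rewrite ia_pointS ptE// !mxE eqxx; split=> //.
have [r [H1 H2 H3 H4]] := IH i im.
by exists r; rewrite !ptE ?(ltnW im)// !mxE -val_eqE/= ltn_eqF.
Qed.
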